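(* Let $\mathsf{F}\colon\mathcal{S}\times\mathcal{T}\to\mathcal{U}$ be a biexact functor of triangulated categories that admits a strong Verdier structure. Then \[ \operatorname{level}^{\mathsf{F}(X,X')}_{\mathcal{U}}\bigl(\mathsf{F}(Y,Y')\bigr)\le\operatorname{level}^X_{\mathcal{S}}(Y)+\operatorname{level}^{X'}_{\mathcal{T}}(Y')-1 \] for all objects $X,Y$ of $\mathcal{S}$ and $X',Y'$ of $\mathcal{T}$.
   Context: Biexact: $\mathsf{F}$ is a bifunctor with natural isomorphisms $\theta\colon\mathsf{F}(\Sigma-,-)\to\Sigma\mathsf{F}(-,-)$, $\zeta\colon\mathsf{F}(-,\Sigma-)\to\Sigma\mathsf{F}(-,-)$ such that for every $X$, $\mathsf{F}(X,-)$ with $\zeta(X,-)$ is exact (i.e. sends an exact triangle $A\xrightarrow{a}B\xrightarrow{b}C\xrightarrow{c}\Sigma A$ to the exact triangle $\mathsf{F}(X,A)\to\mathsf{F}(X,B)\to\mathsf{F}(X,C)\xrightarrow{\zeta\circ\mathsf{F}(X,c)}\Sigma\mathsf{F}(X,A)$), likewise $\mathsf{F}(-,X')$ with $\theta(-,X')$, and $(\Sigma\zeta)\circ\theta=-(\Sigma\theta)\circ\zeta$ as maps $\mathsf{F}(\Sigma X,\Sigma X')\to\Sigma^2\mathsf{F}(X,X')$. A commutative square $T\to V$, $T\to U$, $V\to P$, $U\to P$ (maps $g,f,f',g'$) is homotopy cartesian if there is an exact triangle $T\xrightarrow{\binom{f}{-g}}U\oplus V\xrightarrow{(g'\ f')}P\to\Sigma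 T$. Strong Verdier structure: for all exact triangles $X\xrightarrow{f}Y\xrightarrow{g}Z\xrightarrow{h}\Sigma X$ in $\mathcal{S}$ and $X'\xrightarrow{f'}Y'\xrightarrow{g'}Z'\xrightarrow{h'}\Sigma X'$ in $\mathcal{T}$ there exist an object $W$ of $\mathcal{U}$ and exact triangles $\mathsf{F}(X,Y')\xrightarrow{j}W\xrightarrow{q}\mathsf{F}(Z,X')\xrightarrow{\theta\mathsf{F}(h,f')}\Sigma\mathsf{F}(X,Y')$, $W\xrightarrow{i}\mathsf{F}(Y,Y')\xrightarrow{\mathsf{F}(g,g')}\mathsf{F}(Z,Z')\xrightarrow{p}\Sigma W$, $\mathsf{F}(Y,X')\xrightarrow{j'}W\xrightarrow{q'}\mathsf{F}(X,Z')\xrightarrow{\zeta\mathsf{F}(f,h')}\Sigma\mathsf{F}(Y,X')$, such that $q'j=\mathsf{F}(X,g')$, $ij=\mathsf{F}(f,Y')$, $ij'=\mathsf{F}(Y,f')$, $qj'=\mathsf{F}(g,X')$, $(\Sigma q)p=\zeta\mathsf{F}(Z,h')$, $(\Sigma q')p=\theta\mathsf{F}(h,Z')$, and the following squares commute and are homotopy cartesian: (I) $j'\mathsf{F}(f,X')=j\mathsf{F}(X,f')$ from $\mathsf{F}(X,X')$ to $W$; (II) $\mathsf{F}(g,Y')i=\mathsf{F}(Z,f')q$ from $W$ to $\mathsf{F}(Z,Y')$; (III) $\mathsf{F}(Y,g')i=\mathsf{F}(f,Z')q'$ from $W$ to $\mathsf{F}(Y,Z')$; (IV) $p\,\mathsf{F}(Z,g')=(\Sigma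 j)\theta\mathsf{F}(h,Y')$ from $\mathsf{F}(Z,Y')$ to $\Sigma W$; (V) $p\,\mathsf{F}(g,Z')=(\Sigma j')\zeta\mathsf{F}(Y,h')$ from $\mathsf{F}(Y,Z')$ to $\Sigma W$; and (VI) the square from $\Sigma W$ to $\Sigma^2\mathsf{F}(X,X')$ formed by $\Sigma(\zeta\mathsf{F}(X,h'))\circ\Sigma q'$ and $\Sigma(\theta\mathsf{F}(h,X'))\circ\Sigma q$ anti-commutes and becomes homotopy cartesian after replacing one of its morphisms by its negative. Level: $\operatorname{thick}^0(X)$ = zero objects; $\operatorname{thick}^1(X)$ = smallest full subcategory containing $X$ closed under (de)suspension, finite coproducts and retracts; for $n\ge2$, $Y\in\operatorname{thick}^n(X)$ iff there is an exact triangle $Y'\to Y\oplus\tilde Y\to Y''\to\Sigma Y'$ with $Y'\in\operatorname{thick}^1(X)$, $Y''\in\operatorname{thick}^{n-1}(X)$; $\operatorname{level}^X(Y)=\inf\{n\ge0:Y\in\operatorname{thick}^n(X)\}$.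
   Formalization: When Y and Y' are both zero objects, both levels are 0 and the right-hand side would be −1, which is false since F(Y,Y') has level 0; in that case the bound is taken to be 0 instead. *)

(* Defs.v *)
From HB Require Import structures.
From mathcomp Require Import all_boot all_algebra.
Set Implicit Arguments. Unset Strict Implicit. Unset Printing Implicit Defensive.
Import GRing.Theory.
Local Open Scope ring_scope.

Record preadd := PreAdd {
  ob :> Type;
  mor : ob -> ob -> zmodType;
  cmp : forall X Y Z : ob, mor Y Z -> mor X Y -> mor X Z;
  idm : forall X : ob, mor X X;
  cmpA : forall (X Y Z W : ob) (h : mor Z W) (g : mor Y Z) (f : mor X Y),
      cmp h (cmp g f) = cmp (cmp h g) f;
  cmp1m : forall (X Y : ob) (f : mor X Y), cmp (idm Y) f = f;
  cmpm1 : forall (X Y : ob) (f : mor X Y), cmp f (idm X) = f;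
  cmpDl : forall (X Y Z : ob) (g g' : mor Y Z) (f : mor X Y),
      cmp (g + g') f = cmp g f + cmp g' f;
  cmpDr : forall (X Y Z : ob) (g : mor Y Z) (f f' : mor X Y),
      cmp g (f + f') = cmp g f + cmp g f'
}.
Arguments mor {p}.
Arguments cmp {p X Y Z}.
Arguments idm {p}.

Section Basic.
Variable C : preadd.

Definition is_zero (Z : C) : Prop :=
  forall W : C, (forall f : mor Z W, f = 0) /\ (forall f : mor W Z, f = 0).

Definition is_iso (X Y : C) (f : mor X Y) : Prop :=
  exists g : mor Y X, cmp g f = idm X /\ cmp f g = idm Y.

Definition is_biprod (A B S : C) (i1 : mor A S) (i2 : mor B S)
    (p1 : mor S A) (p2 : mor S B) : Prop :=
  [/\ cmp p1 i1 = idm A, cmp p2 i2 = idm B, cmp p1 i2 = 0, cmp p2 i1 = 0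
    & cmp i1 p1 + cmp i2 p2 = idm S].

Definition has_biprod (A B S : C) : Prop :=
  exists (i1 : mor A S) (i2 : mor B S) (p1 : mor S A) (p2 : mor S B),
    is_biprod i1 i2 p1 p2.
End Basic.

Section TriangAxioms.
Variable C : preadd.
Variable sus : C -> C.
Variable susm : forall X Y : C, mor X Y -> mor (sus X) (sus Y).
Variable tri : forall X Y Z : C, mor X Y -> mor Y Z -> mor Z (sus X) -> Prop.
Arguments susm {X Y}.
Arguments tri {X Y Z}.

Definition triang_axioms : Prop :=
  [/\ (forall X : C, susm (idm X) = idm (sus X)),
      (forall (X Y Z : C) (g : mor Y Z) (f : mor X Y),
          susm (cmp g f) = cmp (susm g) (susm f)),
      (forall (X Y : C) (f g : mor X Y), susm (f + g) = susm f + susm g),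
      (forall X Y : C, bijective (@susm X Y)) &
      (forall Y : C, exists (X : C) (f : mor (sus X) Y), is_iso f)] /\
  ((exists Z : C, is_zero Z) /\ (forall A B : C, exists S : C, has_biprod A B S)) /\
  (forall (X Y Z X' Y' Z' : C) (f : mor X Y) (g : mor Y Z) (h : mor Z (sus X))
          (f' : mor X' Y') (g' : mor Y' Z') (h' : mor Z' (sus X'))
          (u : mor X X') (v : mor Y Y') (w : mor Z Z'),
      tri f g h -> is_iso u -> is_iso v -> is_iso w ->
      cmp v f = cmp f' u -> cmp w g = cmp g' v ->
      cmp (susm u) h = cmp h' w -> tri f' g' h') /\
  (forall (X Z : C), is_zero Z ->
      tri (idm X) (0 : mor X Z) (0 : mor Z (sus X))) /\
  (forall (X Y : C) (f : mor X Y),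
      exists (Z : C) (g : mor Y Z) (h : mor Z (sus X)), tri f g h) /\
  (forall (X Y Z : C) (f : mor X Y) (g : mor Y Z) (h : mor Z (sus X)),
      tri f g h <-> tri g h (- susm f)) /\
  (forall (X Y Z X' Y' Z' : C) (f : mor X Y) (g : mor Y Z) (h : mor Z (sus X))
          (f' : mor X' Y') (g' : mor Y' Z') (h' : mor Z' (sus X'))
          (u : mor X X') (v : mor Y Y'),
      tri f g h -> tri f' g' h' -> cmp v f = cmp f' u ->
      exists w : mor Z Z', cmp w g = cmp g' v /\ cmp (susm u) h = cmp h' w) /\
  (forall (X Y Z Z' X' Y' : C) (f : mor X Y) (g : mor Y Z)
          (f1 : mor Y Z') (f2 : mor Z' (sus X))
          (g1 : mor Z X') (g2 : mor X' (sus Y))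
          (h1 : mor Z Y') (h2 : mor Y' (sus X)),
      tri f f1 f2 -> tri g g1 g2 -> tri (cmp g f) h1 h2 ->
      exists (u : mor Z' Y') (v : mor Y' X'),
        [/\ tri u v (cmp (susm f1) g2),
            cmp u f1 = cmp h1 g, cmp h2 u = f2,
            cmp v h1 = g1 & cmp g2 v = cmp (susm f) h2]).
End TriangAxioms.

Record triang (C : preadd) := Triang {
  sus : C -> C;
  susm : forall X Y : C, mor X Y -> mor (sus X) (sus Y);
  tri : forall X Y Z : C, mor X Y -> mor Y Z -> mor Z (sus X) -> Prop;
  triangP : triang_axioms susm tri
}.
Arguments sus {C} t.
Arguments susm {C} t {X Y}.
Arguments tri {C} t {X Y Z}.

(* Homotopy cartesian squares: the square
      T --g--> V
      |f       |f'
      U --g'-> P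
   commutes and there is an exact triangle
      T --(f ; -g)--> U (+) V --(g' f')--> P --> Sigma T.                *)
Definition hcart (C : preadd) (TC : triang C) (T U V P : C)
    (f : mor T U) (g : mor T V) (g' : mor U P) (f' : mor V P) : Prop :=
  cmp g' f = cmp f' g /\
  exists (S : C) (i1 : mor U S) (i2 : mor V S) (p1 : mor S U) (p2 : mor S V),
    is_biprod i1 i2 p1 p2 /\
    exists h : mor P (sus TC T),
      tri TC (cmp i1 f - cmp i2 g) (cmp g' p1 + cmp f' p2) h.

Record bifun (S T U : preadd) := Bifun {
  F0 : S -> T -> U;
  F1 : forall (X Y : S) (X' Y' : T), mor X Y -> mor X' Y' -> mor (F0 X X') (F0 Y Y');
  F1_id : forall (X : S) (X' : T), F1 (idm X) (idm X') = idm (F0 X X');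
  F1_comp : forall (X Y Z : S) (X' Y' Z' : T) (g : mor Y Z) (f : mor X Y)
      (g' : mor Y' Z') (f' : mor X' Y'),
      F1 (cmp g f) (cmp g' f') = cmp (F1 g g') (F1 f f')
}.
Arguments F0 {S T U} b.
Arguments F1 {S T U} b {X Y X' Y'}.

Definition biexact (S T U : preadd) (TS : triang S) (TT : triang T) (TU : triang U)
    (F : bifun S T U)
    (theta : forall (X : S) (X' : T), mor (F0 F (sus TS X) X') (sus TU (F0 F X X')))
    (zeta : forall (X : S) (X' : T), mor (F0 F X (sus TT X')) (sus TU (F0 F X X')))
    : Prop :=
  (forall (X : S) (X' : T), is_iso (theta X X') /\ is_iso (zeta X X')) /\
  (forall (X Y : S) (X' Y' : T) (f : mor X Y) (g : mor X' Y'),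
      cmp (susm TU (F1 F f g)) (theta X X') = cmp (theta Y Y') (F1 F (susm TS f) g)) /\
  (forall (X Y : S) (X' Y' : T) (f : mor X Y) (g : mor X' Y'),
      cmp (susm TU (F1 F f g)) (zeta X X') = cmp (zeta Y Y') (F1 F f (susm TT g))) /\
  (forall (X : S) (A B : T) (a a' : mor A B),
      F1 F (idm X) (a + a') = F1 F (idm X) a + F1 F (idm X) a') /\
  (forall (X' : T) (A B : S) (a a' : mor A B),
      F1 F (a + a') (idm X') = F1 F a (idm X') + F1 F a' (idm X')) /\
  (forall (X : S) (A B C : T) (a : mor A B) (b : mor B C) (c : mor C (sus TT A)),
      tri TT a b c ->
      tri TU (F1 F (idm X) a) (F1 F (idm X) b) (cmp (zeta X A) (F1 F (idm X) c))) /\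
  (forall (X' : T) (A B C : S) (a : mor A B) (b : mor B C) (c : mor C (sus TS A)),
      tri TS a b c ->
      tri TU (F1 F a (idm X')) (F1 F b (idm X')) (cmp (theta A X') (F1 F c (idm X')))) /\
  (forall (X : S) (X' : T),
      cmp (susm TU (zeta X X')) (theta X (sus TT X')) =
      - cmp (susm TU (theta X X')) (zeta (sus TS X) X')).

Definition strong_verdier (S T U : preadd) (TS : triang S) (TT : triang T) (TU : triang U)
    (F : bifun S T U)
    (theta : forall (X : S) (X' : T), mor (F0 F (sus TS X) X') (sus TU (F0 F X X')))
    (zeta : forall (X : S) (X' : T), mor (F0 F X (sus TT X')) (sus TU (F0 F X X')))
    : Prop :=
  forall (X Y Z : S) (f : mor X Y) (g : mor Y Z) (h : mor Z (sus TS X))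
         (X' Y' Z' : T) (f' : mor X' Y') (g' : mor Y' Z') (h' : mor Z' (sus TT X')),
  tri TS f g h -> tri TT f' g' h' ->
  exists (W : U)
         (j : mor (F0 F X Y') W) (q : mor W (F0 F Z X'))
         (i : mor W (F0 F Y Y')) (p : mor (F0 F Z Z') (sus TU W))
         (j' : mor (F0 F Y X') W) (q' : mor W (F0 F X Z')),
  [/\ tri TU j q (cmp (theta X Y') (F1 F h f')),
      tri TU i (F1 F g g') p &
      tri TU j' q' (cmp (zeta Y X') (F1 F f h'))] /\
  [/\ cmp q' j = F1 F (idm X) g',
      cmp i j = F1 F f (idm Y') &
      cmp i j' = F1 F (idm Y) f'] /\
  [/\ cmp q j' = F1 F g (idm X'),
      cmp (susm TU q) p = cmp (zeta Z X') (F1 F (idm Z) h') &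
      cmp (susm TU q') p = cmp (theta X Z') (F1 F h (idm Z'))] /\
  [/\ hcart TU (F1 F (idm X) f') (F1 F f (idm X')) j j',
      hcart TU i q (F1 F g (idm Y')) (F1 F (idm Z) f'),
      hcart TU i q' (F1 F (idm Y) g') (F1 F f (idm Z')),
      hcart TU (F1 F (idm Z) g') (cmp (theta X Y') (F1 F h (idm Y'))) p (susm TU j) &
      hcart TU (F1 F g (idm Z')) (cmp (zeta Y X') (F1 F (idm Y) h')) p (susm TU j')] /\
  (let a := susm TU q' in
   let b := susm TU q in
   let c := susm TU (cmp (zeta X X') (F1 F (idm X) h')) in
   let d := susm TU (cmp (theta X X') (F1 F h (idm X'))) in
   cmp c a = - cmp d b /\
   [\/ hcart TU (- a) b c d, hcart TU a (- b) c d,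
       hcart TU a b (- c) d | hcart TU a b c (- d)]).

Section Level.
Variables (C : preadd) (TC : triang C) (X : C).

Inductive thick1 : C -> Prop :=
  | thick1_base : thick1 X
  | thick1_sus : forall A : C, thick1 A -> thick1 (sus TC A)
  | thick1_desus : forall A : C, thick1 (sus TC A) -> thick1 A
  | thick1_zero : forall Z : C, is_zero Z -> thick1 Z
  | thick1_coprod : forall A B S : C, thick1 A -> thick1 B -> has_biprod A B S -> thick1 S
  | thick1_retract : forall (A B : C) (r : mor A B) (s : mor B A),
      thick1 A -> cmp r s = idm B -> thick1 B.

Fixpoint thick (n : nat) : C -> Prop :=
  match n with
  | 0%N => fun Y => is_zero Y
  | S m =>
    match m with
    | 0%N => thick1
    | S _ => fun Y =>
        exists (Y1 Y2 Yt Sm : C) (a : mor Y1 Sm) (b : mor Sm Y2) (c : mor Y2 (sus TC Y1)),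
          [/\ thick1 Y1, thick m Y2, has_biprod Y Yt Sm & tri TC a b c]
    end
  end.

(* level^X(Y) <= k  (level is an infimum in nat \cup {oo}) *)
Definition level_le (Y : C) (k : nat) : Prop :=
  exists n : nat, (n <= k)%N /\ thick n Y.
End Level.

Arguments biexact {S T U} TS TT TU F theta zeta.
Arguments strong_verdier {S T U} TS TT TU F theta zeta.
Arguments level_le {C} TC X Y k.
Arguments thick {C} TC X n _.
Arguments hcart {C} TC {T U V P} f g g' f'.

(* Main.v *)
(* Up to retracts, Y and Y' are the ends of towers Y_1 -> ... -> Y_m and
   Y'_1 -> ... -> Y'_n with Y_1, Y'_1 and all cones gr_i, gr'_j in thick^1. Filter
   F(Y, Y') by the unions G_k of the F(Y_i, Y'_j) with i + j = k + 1, for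
   k = 1, ..., m + n - 1: the cone of G_{k-1} -> G_k is the direct sum of the
   F(gr_i, gr'_j) with i + j = k + 1, which lies in thick^1. The G_k are built by
   iterated homotopy pushouts, one triangle X -> Y -> Z of the first tower at a
   time; the objects W of the strong Verdier structure provide the strictly
   commuting squares with which the maps F(Y_m, Y'_j) -> G_{m+j-1} can be chosen
   compatibly in j. *)

Require Import Defs.
From mathcomp Require Import all_boot all_algebra.
Set Implicit Arguments. Unset Strict Implicit. Unset Printing Implicit Defensive.
Import GRing.Theory.

Notation "g \c f" := (cmp g f) (at level 40, left associativity).

(** * Preadditive categories: zero maps, signs, biproducts *)

Section Preadditive.
Local Open Scope ring_scope.
Variable C : preadd.
Implicit Types X Y Z A B S : C.

Lemma cmp0l X Y Z (f : mor X Y) : (0 : mor Y Z) \c f = 0.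
Proof. by apply: (addrI (0 \c f)); rewrite -cmpDl !addr0. Qed.

Lemma cmp0r X Y Z (g : mor Y Z) : g \c (0 : mor X Y) = 0.
Proof. by apply: (addrI (g \c 0)); rewrite -cmpDr !addr0. Qed.

Lemma cmpNl X Y Z (g : mor Y Z) (f : mor X Y) : (- g) \c f = - (g \c f).
Proof. by apply: (addrI (g \c f)); rewrite -cmpDl !subrr cmp0l. Qed.

Lemma cmpNr X Y Z (g : mor Y Z) (f : mor X Y) : g \c (- f) = - (g \c f).
Proof. by apply: (addrI (g \c f)); rewrite -cmpDr !subrr cmp0r. Qed.

Definition cmp_lin := (cmpDl, cmpDr, cmpNl, cmpNr, cmp0l, cmp0r, cmp1m, cmpm1).

Lemma is_iso_idm X : is_iso (idm X).
Proof. by exists (idm X); rewrite cmp1m. Qed.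

Lemma is_isoN X Y (f : mor X Y) : is_iso f -> is_iso (- f).
Proof. by case=> g [gf fg]; exists (- g); rewrite !(cmpNl, cmpNr) !opprK. Qed.

Lemma is_zeroP Z : idm Z = 0 -> is_zero Z.
Proof.
move=> Z0 W; split=> f.
- by rewrite -(cmpm1 f) Z0 cmp0r.
- by rewrite -(cmp1m f) Z0 cmp0l.
Qed.

Lemma biprodC A B S (i1 : mor A S) (i2 : mor B S) (p1 : mor S A) (p2 : mor S B) :
  is_biprod i1 i2 p1 p2 -> is_biprod i2 i1 p2 p1.
Proof. by case=> ? ? ? ? e; split=> //; rewrite addrC. Qed.

Lemma split_biprod A B S (i1 : mor A S) (i2 : mor B S) (p2 : mor S B) (k : mor S A) :
  p2 \c i2 = idm B -> p2 \c i1 = 0 -> k \c i1 = idm A ->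
  i1 \c k = idm S - i2 \c p2 -> is_biprod i1 i2 k p2.
Proof.
move=> e22 e21 e11 e; split=> //; last by rewrite e subrK.
have z : i1 \c k \c i2 = 0 by rewrite e !cmp_lin -cmpA e22 cmpm1 subrr.
by rewrite -(cmp1m (k \c i2)) -e11 -cmpA (cmpA i1) z cmp0r.
Qed.

End Preadditive.

(** * Exact triangles: rotation, signs, lifting, splitting *)

Section Triangulated.
Local Open Scope ring_scope.
Variables (C : preadd) (TC : triang C).
Implicit Types X Y Z A B S : C.
Local Notation "'Σ'" := (sus TC).
Local Notation "'Σ1'" := (susm TC).
Local Notation tri := (tri TC).

Lemma susm_id X : Σ1 (idm X) = idm (Σ X).
Proof. by case: (triangP TC) => -[]. Qed.

Lemma susm_comp X Y Z (g : mor Y Z) (f : mor X Y) : Σ1 (g \c f) = Σ1 g \c Σ1 f.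
Proof. by case: (triangP TC) => -[]. Qed.

Lemma susmD X Y (f g : mor X Y) : Σ1 (f + g) = Σ1 f + Σ1 g.
Proof. by case: (triangP TC) => -[]. Qed.

Lemma susm_bij X Y : bijective (@susm _ TC X Y).
Proof. by case: (triangP TC) => -[]. Qed.

Lemma susm0 X Y : Σ1 (0 : mor X Y) = 0.
Proof. by apply: (addrI (Σ1 0)); rewrite -susmD !addr0. Qed.

Lemma susm_inj X Y : injective (@susm _ TC X Y).
Proof. exact: bij_inj (susm_bij X Y). Qed.

Lemma susm_surj X Y (f : mor (Σ X) (Σ Y)) : exists g : mor X Y, Σ1 g = f.
Proof. by case: (susm_bij X Y) => g _ fg; exists (g f). Qed.

Lemma desuspension Y : exists X (f : mor (Σ X) Y), is_iso f.
Proof. by case: (triangP TC) => -[_ _ _ _ h] _; apply: h. Qed.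

Lemma zero_object : exists Z : C, is_zero Z.
Proof. by case: (triangP TC) => _ [[]]. Qed.

Lemma biprod_ex A B : exists S (i1 : mor A S) (i2 : mor B S) (p1 : mor S A) (p2 : mor S B),
  is_biprod i1 i2 p1 p2.
Proof. by case: (triangP TC) => _ [[_ h] _]; apply: h. Qed.

Lemma tri_iso X Y Z X' Y' Z' (f : mor X Y) (g : mor Y Z) (h : mor Z (Σ X))
    (f' : mor X' Y') (g' : mor Y' Z') (h' : mor Z' (Σ X'))
    (u : mor X X') (v : mor Y Y') (w : mor Z Z') :
  tri f g h -> is_iso u -> is_iso v -> is_iso w ->
  v \c f = f' \c u -> w \c g = g' \c v -> Σ1 u \c h = h' \c w -> tri f' g' h'.
Proof. by case: (triangP TC) => _ [_ [ax _]]; apply: ax. Qed.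

Lemma tri_id X Z : is_zero Z -> tri (idm X) (0 : mor X Z) 0.
Proof. by case: (triangP TC) => _ [_ [_ [ax _]]]; apply: ax. Qed.

Lemma tri_cone X Y (f : mor X Y) : exists Z (g : mor Y Z) (h : mor Z (Σ X)), tri f g h.
Proof. by case: (triangP TC) => _ [_ [_ [_ [ax _]]]]; apply: ax. Qed.

Lemma tri_rot X Y Z (f : mor X Y) (g : mor Y Z) (h : mor Z (Σ X)) :
  tri f g h <-> tri g h (- Σ1 f).
Proof. by case: (triangP TC) => _ [_ [_ [_ [_ [ax _]]]]]; apply: ax. Qed.

Lemma tri_fill X Y Z X' Y' Z' (f : mor X Y) (g : mor Y Z) (h : mor Z (Σ X))
    (f' : mor X' Y') (g' : mor Y' Z') (h' : mor Z' (Σ X')) (u : mor X X') (v : mor Y Y') :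
  tri f g h -> tri f' g' h' -> v \c f = f' \c u ->
  exists w : mor Z Z', w \c g = g' \c v /\ Σ1 u \c h = h' \c w.
Proof. by case: (triangP TC) => _ [_ [_ [_ [_ [_ [ax _]]]]]]; apply: ax. Qed.

Lemma octahedron X Y Z Z' X' Y' (f : mor X Y) (g : mor Y Z)
    (f1 : mor Y Z') (f2 : mor Z' (Σ X)) (g1 : mor Z X') (g2 : mor X' (Σ Y))
    (h1 : mor Z Y') (h2 : mor Y' (Σ X)) :
  tri f f1 f2 -> tri g g1 g2 -> tri (g \c f) h1 h2 ->
  exists (u : mor Z' Y') (v : mor Y' X'),
    [/\ tri u v (Σ1 f1 \c g2), u \c f1 = h1 \c g, h2 \c u = f2,
        v \c h1 = g1 & g2 \c v = Σ1 f \c h2].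
Proof. by case: (triangP TC) => _ [_ [_ [_ [_ [_ [_ ax]]]]]]; apply: ax. Qed.

Lemma tri_rot3 X Y Z (f : mor X Y) (g : mor Y Z) (h : mor Z (Σ X)) :
  tri f g h <-> tri h (- Σ1 f) (- Σ1 g).
Proof. by split=> [/tri_rot/tri_rot//|t]; apply/tri_rot/tri_rot. Qed.

Lemma tri_sign12 X Y Z (f : mor X Y) (g : mor Y Z) (h : mor Z (Σ X)) :
  tri f g h -> tri (- f) (- g) h.
Proof.
move=> t; apply: (tri_iso (u := idm X) (v := - idm Y) (w := idm Z) t).
all: rewrite ?susm_id ?cmp_lin ?opprK //.
all: by [exact: is_iso_idm | apply/is_isoN/is_iso_idm].
Qed.

Lemma tri_sign23 X Y Z (f : mor X Y) (g : mor Y Z) (h : mor Z (Σ X)) :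
  tri f g h -> tri f (- g) (- h).
Proof.
move=> t; apply: (tri_iso (u := idm X) (v := idm Y) (w := - idm Z) t).
all: rewrite ?susm_id ?cmp_lin ?opprK //.
all: by [exact: is_iso_idm | apply/is_isoN/is_iso_idm].
Qed.

Lemma tri_sign13 X Y Z (f : mor X Y) (g : mor Y Z) (h : mor Z (Σ X)) :
  tri f g h -> tri (- f) g (- h).
Proof. by move=> /tri_sign12/tri_sign23; rewrite opprK. Qed.

Lemma tri_comp0 X Y Z (f : mor X Y) (g : mor Y Z) (h : mor Z (Σ X)) :
  tri f g h -> g \c f = 0.
Proof.
move=> t; have [O O0] := zero_object.
have [|w [wg _]] := tri_fill (u := idm X) (v := f) (tri_id X O0) t; first by [].
by rewrite -wg cmp0r.
Qed.

Lemma tri_comp0' X Y Z (f : mor X Y) (g : mor Y Z) (h : mor Z (Σ X)) :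
  tri f g h -> h \c g = 0.
Proof. by move/tri_rot/tri_comp0. Qed.

Lemma tri_comp0'' X Y Z (f : mor X Y) (g : mor Y Z) (h : mor Z (Σ X)) :
  tri f g h -> Σ1 f \c h = 0.
Proof. by move/tri_rot/tri_comp0'; rewrite cmpNl => /eqP; rewrite oppr_eq0 => /eqP. Qed.

Lemma tri_factor X Y Z M (f : mor X Y) (g : mor Y Z) (h : mor Z (Σ X)) (x : mor Y M) :
  tri f g h -> x \c f = 0 -> exists y : mor Z M, x = y \c g.
Proof.
move=> t xf; have [O O0] := zero_object.
(* Rotating 0 -> M = M puts the suspension of the source in third place, so the zero object is taken
   as a desuspension and both it and its suspension are shown to vanish. *)
have [O' [o [k [ko _]]]] := desuspension O.
have O'0 : is_zero O'.
  apply: is_zeroP; apply: susm_inj; rewrite susm_id susm0.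
  by rewrite -ko; case: (O0 (Σ O')) => _ /(_ o) ->; rewrite cmp0r.
have t0 : tri (0 : mor O' M) (idm M) (0 : mor M (Σ O')).
  apply/tri_rot; rewrite susm0 oppr0.
  have SO0 : is_zero (Σ O').
    apply: is_zeroP; rewrite -susm_id -susm0; congr susm.
    by case: (O'0 O') => /(_ (idm O')).
  exact: (tri_id M SO0).
have [|w [wg _]] := tri_fill (u := 0) (v := x) t t0; first by rewrite xf cmp0l.
by exists w; rewrite wg cmp1m.
Qed.

Lemma tri_factor3 X Y Z M (f : mor X Y) (g : mor Y Z) (h : mor Z (Σ X)) (x : mor Z M) :
  tri f g h -> x \c g = 0 -> exists y : mor (Σ X) M, x = y \c h.
Proof. by move/tri_rot; apply: tri_factor. Qed.

Lemma tri_lift X Y Z M (f : mor X Y) (g : mor Y Z) (h : mor Z (Σ X)) (x : mor M Y) :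
  tri f g h -> g \c x = 0 -> exists y : mor M X, x = f \c y.
Proof.
move=> t gx; have [O O0] := zero_object.
have t0 : tri (0 : mor M O) 0 (- Σ1 (idm M)) by have /tri_rot := tri_id M O0.
have [|w [_ e]] := tri_fill (u := x) (v := 0) t0 (proj1 (tri_rot _ _ _) t).
  by rewrite gx cmp0l.
have [y wy] := susm_surj w; exists y; apply: susm_inj.
by move: e; rewrite susm_id !cmp_lin -wy -susm_comp => /oppr_inj.
Qed.

Lemma tri_lift3 X Y Z M (f : mor X Y) (g : mor Y Z) (h : mor Z (Σ X)) (x : mor M Z) :
  tri f g h -> h \c x = 0 -> exists y : mor M Y, x = g \c y.
Proof. by move/tri_rot; apply: tri_lift. Qed.

(** The difference n = w - 1 satisfies n g = 0 and h n = 0. The first makes n factor through h, so n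
    n = 0 by the second, and 1 - n inverts w. *)
Lemma tri_end_iso X Y Z (f : mor X Y) (g : mor Y Z) (h : mor Z (Σ X)) (w : mor Z Z) :
  tri f g h -> w \c g = g -> h \c w = h -> is_iso w.
Proof.
move=> t wg hw; have [n nE] : exists n, n = w - idm Z by exists (w - idm Z).
have [|s ns] := tri_factor3 (x := n) t; first by rewrite nE !cmp_lin wg subrr.
have hn : h \c n = 0 by rewrite nE !cmp_lin hw subrr.
have nn : n \c n = 0 by rewrite {1}ns -cmpA hn cmp0r.
have -> : w = idm Z + n by rewrite nE addrC subrK.
exists (idm Z - n); split; rewrite !(cmpDl, cmpDr) !cmp_lin nn ?oppr0 ?addr0 ?addrK ?subrK //.
Qed.

(** Desuspend the cone of [c]. The signs in the witnesses cancel those of the double rotation. *)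
Lemma tri_fiber N Y (c : mor N (Σ Y)) : exists M (b : mor Y M) (n : mor M N), tri b n c.
Proof.
have [L [g [h t]]] := tri_cone c; have [M [l [l' [l'l ll']]]] := desuspension L.
have [b bE] := susm_surj (- (l' \c g)); have [n nE] := susm_surj (- (h \c l)).
exists M, b, n; apply/tri_rot3; rewrite bE nE !opprK.
apply: (tri_iso (u := idm N) (v := idm (Σ Y)) (w := l') t).
all: rewrite ?susm_id ?cmp_lin -?cmpA ?ll' ?cmpm1 //.
all: by [exact: is_iso_idm | exists l].
Qed.

(** In the triangle on [i1] the connecting map vanishes because [i1] is a split monomorphism. The
    map from its cone to B induced by [p2] then has inverse g i2. *)
Lemma biprod_tri A B S (i1 : mor A S) (i2 : mor B S) (p1 : mor S A) (p2 : mor S B) :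
  is_biprod i1 i2 p1 p2 -> tri i1 p2 0.
Proof.
case=> e11 e22 e12 e21 e; have [Z [g [h t]]] := tri_cone i1.
have h0 : h = 0.
  by rewrite -(cmp1m h) -susm_id -e11 susm_comp -cmpA (tri_comp0'' t) cmp0r.
have [k kg] := tri_factor t e21.
have gp : g \c i2 \c p2 = g.
  by rewrite -[RHS]cmpm1 -e cmpDr !cmpA (tri_comp0 t) cmp0l add0r.
have gik : g \c i2 \c k = idm Z.
  have [|s] := tri_factor3 (x := g \c i2 \c k - idm Z) t.
    by rewrite !cmp_lin -cmpA -kg gp subrr.
  by rewrite h0 cmp0r => /eqP; rewrite subr_eq0 => /eqP.
apply: (tri_iso (u := idm A) (v := idm S) (w := k) t).
all: rewrite ?susm_id ?cmp_lin -?kg //.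
all: try exact: is_iso_idm.
by exists (g \c i2); rewrite gik cmpA -kg.
Qed.

(** The section [s] is prescribed by the caller. The projection to A lifts 1 - s v through [u],
    which is a monomorphism since the connecting map is 0. *)
Lemma tri_split_biprod A B S (u : mor A S) (v : mor S B) (s : mor B S) :
  tri u v 0 -> v \c s = idm B -> exists k : mor S A, is_biprod u s k v.
Proof.
move=> t vs.
have [|k ek] := tri_lift (x := idm S - s \c v) t.
  by rewrite !cmp_lin cmpA vs cmp1m subrr.
exists k; apply: (split_biprod vs (tri_comp0 t) _ (esym ek)).
have /tri_rot tr := t.
have e : u \c (k \c u - idm A) = 0.
  by rewrite !cmp_lin cmpA -ek !cmp_lin -cmpA (tri_comp0 t) cmp0r subr0 subrr.
have e' : (- Σ1 u) \c Σ1 (k \c u - idm A) = 0 by rewrite cmpNl -susm_comp e susm0 oppr0.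
have [y] := tri_lift3 tr e'; rewrite cmp0l => /eqP.
by rewrite -susm0 => /eqP/susm_inj/eqP; rewrite subr_eq0 => /eqP.
Qed.

Lemma tri_split A B S (u : mor A S) (v : mor S B) : tri u v 0 -> has_biprod A B S.
Proof.
move=> t; have [|s vs] := tri_lift3 (x := idm B) t; first by rewrite cmp0l.
have [k b] := tri_split_biprod t (esym vs).
by exists u, s, k, v.
Qed.

Lemma retract_summand A S (s : mor A S) (r : mor S A) :
  r \c s = idm A -> exists B, has_biprod A B S.
Proof.
move=> rs; have [B [v [h t]]] := tri_cone s.
have h0 : h = 0.
  by rewrite -(cmp1m h) -susm_id -rs susm_comp -cmpA (tri_comp0'' t) cmp0r.
by exists B; apply: (@tri_split _ _ _ s v); rewrite -h0.
Qed.
End Triangulated.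

(** * Computing with the maps of a biproduct *)

Section BiprodCalculus.
Local Open Scope ring_scope.
Variables (C : preadd) (A B S : C).
Variables (i1 : mor A S) (i2 : mor B S) (p1 : mor S A) (p2 : mor S B).
Hypothesis b : is_biprod i1 i2 p1 p2.

Lemma biprodE :
  ((p1 \c i1 = idm A) * (p2 \c i2 = idm B) * (p1 \c i2 = 0) * (p2 \c i1 = 0) *
   (forall W (x : mor A W), x \c p1 \c i1 = x) * (forall W (x : mor B W), x \c p2 \c i2 = x) *
   (forall W (x : mor A W), x \c p1 \c i2 = 0) *
   (forall W (x : mor B W), x \c p2 \c i1 = 0))%type.
Proof.
case: b => e11 e22 e12 e21 _.
by do !split=> //= *; rewrite -cmpA ?(e11, e22, e12, e21) ?cmpm1 ?cmp0r.
Qed.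

Lemma biprod_hom_ext W (x y : mor S W) : x \c i1 = y \c i1 -> x \c i2 = y \c i2 -> x = y.
Proof.
case: b => _ _ _ _ e e1 e2.
by rewrite -(cmpm1 x) -(cmpm1 y) -e !cmpDr !cmpA e1 e2.
Qed.

End BiprodCalculus.

(** * Homotopy cartesian squares: pushouts, cones, cancellation *)

Section HomotopyCartesian.
Local Open Scope ring_scope.
Variables (C : preadd) (TC : triang C).
Local Notation "'Σ'" := (sus TC).
Local Notation "'Σ1'" := (susm TC).
Local Notation tri := (tri TC).
Local Notation hcart := (hcart TC).

(** The octahedron on X -> Y -> Y + A makes the cone of the composite a split extension of A by Z.
    Choosing the section [h1 \c j2] makes its identification with N carry the maps to the stated
    ones. *)
Lemma tri_add_id X Y Z A S N (f : mor X Y) (g : mor Y Z) (h : mor Z (Σ X))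
    (j1 : mor Y S) (j2 : mor A S) q1 q2 (k1 : mor Z N) (k2 : mor A N) r1 r2 :
  tri f g h -> is_biprod j1 j2 q1 q2 -> is_biprod k1 k2 r1 r2 ->
  tri (j1 \c f) (k1 \c g \c q1 + k2 \c q2) (h \c r1).
Proof.
move=> t bS bN; have [N0 [h1 [h2 t0]]] := tri_cone TC (j1 \c f).
have [u [v []]] := octahedron t (biprod_tri TC bS) t0.
rewrite cmp0r => tuv ug h2u vh1 _.
have [s sE] : exists s, s = h1 \c j2 by exists (h1 \c j2).
have [|k bN0] := tri_split_biprod (s := s) tuv; first by rewrite sE cmpA vh1 (biprodE bS).
have kh1 : k \c h1 = g \c q1.
  apply: (biprod_hom_ext bS); last by rewrite -cmpA -sE !(biprodE bS) (biprodE bN0).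
  by rewrite -cmpA -ug cmpA !(biprodE bS) (biprodE bN0) cmp1m.
have h2E : h2 = h \c k.
  apply: (biprod_hom_ext bN0); first by rewrite h2u !(biprodE bN0).
  by rewrite !(biprodE bN0) sE cmpA (tri_comp0' t0) cmp0l.
apply: (tri_iso (u := idm X) (v := idm S) (w := k1 \c k + k2 \c v) t0).
- exact: is_iso_idm.
- exact: is_iso_idm.
- exists (u \c r1 + s \c r2); split.
    case: (bN0) => _ _ _ _ <-.
    by rewrite !(cmpDl, cmpDr) !cmpA !(biprodE bN) !cmp0l addr0 add0r.
  case: (bN) => _ _ _ _ <-; rewrite !(cmpDl, cmpDr) !cmpA.
  by rewrite !(biprodE bN0) !cmp0l addr0 add0r.
- by rewrite cmp1m cmpm1.
- by rewrite cmpm1 cmpDl -!cmpA kh1 vh1 !cmpA.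
- by rewrite susm_id cmp1m h2E cmpDr !cmpA !(biprodE bN) cmp0l addr0.
Qed.

Lemma hcart_sym T U V P (f : mor T U) (g : mor T V) (g' : mor U P) (f' : mor V P) :
  hcart f g g' f' -> hcart g f f' g'.
Proof.
case=> e [S [i1 [i2 [p1 [p2 [b [h t]]]]]]]; split=> //.
exists S, i2, i1, p2, p1; split; first exact: (biprodC b).
by exists (- h); move/tri_sign13: t; rewrite opprB (addrC (g' \c p1)).
Qed.

Lemma hcart_pushout T U V (f : mor T U) (g : mor T V) :
  exists P (g' : mor U P) (f' : mor V P), hcart f g g' f'.
Proof.
have [S [i1 [i2 [p1 [p2 b]]]]] := biprod_ex TC U V.
have [P [k [h t]]] := tri_cone TC (i1 \c f - i2 \c g).
exists P, (k \c i1), (k \c i2); split.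
  apply/eqP; rewrite -subr_eq0 -!cmpA -cmpNr -cmpDr.
  by rewrite (tri_comp0 t).
exists S, i1, i2, p1, p2; split=> //; exists h.
by rewrite -!cmpA -cmpDr; case: b => _ _ _ _ ->; rewrite cmpm1.
Qed.

Lemma hcart_univ T U V P M (f : mor T U) (g : mor T V) (g' : mor U P) (f' : mor V P)
    (x : mor U M) (y : mor V M) :
  hcart f g g' f' -> x \c f = y \c g -> exists z : mor P M, z \c g' = x /\ z \c f' = y.
Proof.
case=> e [S [i1 [i2 [p1 [p2 [b [h t]]]]]]] exy.
have [|z zE] := tri_factor (x := x \c p1 + y \c p2) t.
  by rewrite !cmp_lin !cmpA !(biprodE b) !cmp0l subr0 add0r exy subrr.
exists z; split.
  have := congr1 (fun k => k \c i1) zE.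
  by rewrite -cmpA !cmpDl !(biprodE b) !addr0.
have := congr1 (fun k => k \c i2) zE.
by rewrite -cmpA !cmpDl !(biprodE b) !add0r.
Qed.

(** The octahedron for [g] as the composite T -> U + V -> V, whose second map is [- p2] and has cone
    ΣU. It gives P -> Q -> ΣU, which is rotated back. *)
Lemma hcart_cone T U V P Q (f : mor T U) (g : mor T V) (g' : mor U P) (f' : mor V P)
    (q : mor V Q) (d : mor Q (Σ T)) :
  hcart f g g' f' -> tri g q d ->
  exists q' : mor P Q, q' \c f' = q /\ tri g' q' (Σ1 f \c d).
Proof.
case=> e [S [i1 [i2 [p1 [p2 [b [h t]]]]]]] tg.
have tp : tri (- p2) (0 : mor V (Σ U)) (Σ1 i1).
  have /tri_rot/tri_sign13 := biprod_tri TC b.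
  by rewrite opprK.
have tc : tri (- p2 \c (i1 \c f - i2 \c g)) q d.
  by rewrite !cmp_lin opprK !cmpA !(biprodE b) cmp0l cmp1m oppr0 add0r.
have [u [v [tuv ut _ _ i1v]]] := octahedron t tp tc.
have vE : v = Σ1 f \c d.
  rewrite -(cmp1m v) -susm_id.
  have <- : p1 \c i1 = idm U by rewrite (biprodE b).
  rewrite susm_comp -cmpA i1v cmpA -susm_comp; congr (susm _ _ \c _).
  by rewrite !cmp_lin !cmpA !(biprodE b) cmp0l subr0 cmp1m.
exists (- u); split.
  have := congr1 (fun k => k \c i2) ut.
  by rewrite -cmpA !cmp_lin !(biprodE b) cmp0r add0r => ->; rewrite opprK.
apply/tri_rot; rewrite -vE; apply: tri_sign13.
by move: tuv; rewrite -susm_comp !cmpDl !(biprodE b) addr0.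
Qed.

(* The octahedron on T -> (U + V) + U' -> U' + V, whose second map is a split
   epimorphism with kernel U. *)
Lemma hcart_cancel T U V P U' P' (f : mor T U) (g : mor T V) (g' : mor U P) (f' : mor V P)
    (k : mor U U') (d : mor U' P') (d' : mor V P') :
  hcart f g g' f' -> hcart (k \c f) g d d' ->
  exists w : mor P P', [/\ w \c g' = d \c k, w \c f' = d' & hcart g' k w d].
Proof.
case=> e0 [S0 [a1 [a2 [b1 [b2 [B0 [h0 t0]]]]]]].
case=> e1 [S1 [c1 [c2 [l1 [l2 [B1 [h1 t1]]]]]]].
have [B [m1 [m2 [n1 [n2 BB]]]]] := biprod_ex TC S0 U'.
have [N [k1 [k2 [r1 [r2 BN]]]]] := biprod_ex TC P U'.
have tX := tri_add_id t0 BB BN.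
(* On elements, [rho] is ((u, v), u') -> (k u + u', v), its kernel [kap] is u -> ((u, 0), - k u),
   and its section [sig] is (u', v) -> ((0, v), u'). *)
have [rho rhoE] : exists r, r = c1 \c k \c b1 \c n1 + c2 \c b2 \c n1 + c1 \c n2 by eexists.
have [kap kapE] : exists r, r = m1 \c a1 - m2 \c k by eexists.
have [sig sigE] : exists r, r = m2 \c l1 + m1 \c a2 \c l2 by eexists.
have BBe : m1 \c n1 + m2 \c n2 = idm B by case: BB.
have B0e : a1 \c b1 + a2 \c b2 = idm S0 by case: B0.
have B1e : c1 \c l1 + c2 \c l2 = idm S1 by case: B1.
have rho1 : rho \c m1 = c1 \c k \c b1 + c2 \c b2.
  by rewrite rhoE !cmpDl !(biprodE BB) addr0.
have rho2 : rho \c m2 = c1 by rewrite rhoE !cmpDl !(biprodE BB) !add0r.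
have rhoa1 : rho \c m1 \c a1 = c1 \c k by rewrite rho1 cmpDl !(biprodE B0) addr0.
have rhoa2 : rho \c m1 \c a2 = c2 by rewrite rho1 cmpDl !(biprodE B0) add0r.
have sigc1 : sig \c c1 = m2 by rewrite sigE !cmpDl !(biprodE B1) addr0.
have sigc2 : sig \c c2 = m1 \c a2 by rewrite sigE !cmpDl !(biprodE B1) add0r.
have Brho : is_biprod kap sig (b1 \c n1) rho.
  split.
  - by rewrite kapE !cmp_lin !cmpA !(biprodE BB) !(biprodE B0) cmp0l subr0.
  - by rewrite sigE !cmp_lin !cmpA rho2 rhoa2.
  - by rewrite sigE !cmp_lin !cmpA !(biprodE BB) !(biprodE B0) !cmp0l addr0.
  - by rewrite kapE !cmp_lin !cmpA rho2 rhoa1 subrr.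
  - apply: (biprod_hom_ext BB); rewrite cmpDl cmp1m.
      apply: (biprod_hom_ext B0); rewrite !cmpDl -!(cmpA sig) ?rhoa1 ?rhoa2 !cmpA.
        by rewrite !(biprodE BB) !(biprodE B0) sigc1 kapE subrK.
      by rewrite !(biprodE BB) !(biprodE B0) add0r.
    by rewrite -(cmpA sig) rho2 !cmpA !(biprodE BB) add0r.
have rhos : rho \c (m1 \c (a1 \c f - a2 \c g)) = c1 \c (k \c f) - c2 \c g.
  by rewrite !cmp_lin !cmpA rhoa1 rhoa2.
have trho : tri rho (0 : mor S1 (Σ U)) (- Σ1 kap).
  by have /tri_rot := biprod_tri TC Brho.
rewrite -rhos in t1.
have [u [v [tuv uf _ _ _]]] := octahedron tX trho t1.
have [q0 q0E] : exists r, r = g' \c b1 + f' \c b2 by eexists.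
have [f1 f1E] : exists r, r = k1 \c q0 \c n1 + k2 \c n2 by eexists.
rewrite -q0E -f1E in tX tuv uf.
have f1m1 : f1 \c m1 = k1 \c q0 by rewrite f1E !cmpDl !(biprodE BB) addr0.
have f1m2 : f1 \c m2 = k2 by rewrite f1E !cmpDl !(biprodE BB) add0r.
have f1kap : f1 \c kap = k1 \c g' - k2 \c k.
  rewrite kapE !cmp_lin !cmpA f1m1 f1m2 q0E -(cmpA k1) cmpDl.
  by rewrite !(biprodE B0) addr0.
have uk2 : u \c k2 = d.
  by rewrite -f1m2 cmpA uf -cmpA rho2 cmpDl !(biprodE B1) addr0.
have uq0 : u \c k1 \c q0 = (d \c l1 + d' \c l2) \c rho \c m1 by rewrite -cmpA -f1m1 cmpA uf.
have g'E : g' = q0 \c a1 by rewrite q0E cmpDl !(biprodE B0) addr0.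
have f'E : f' = q0 \c a2 by rewrite q0E cmpDl !(biprodE B0) add0r.
have wg : u \c k1 \c g' = d \c k.
  rewrite g'E cmpA uq0 -!(cmpA (d \c l1 + d' \c l2)) rhoa1 cmpA cmpDl.
  by rewrite !(biprodE B1) addr0.
have wf : u \c k1 \c f' = d'.
  rewrite f'E cmpA uq0 -!(cmpA (d \c l1 + d' \c l2)) rhoa2 cmpDl.
  by rewrite !(biprodE B1) add0r.
exists (u \c k1); split=> //; split=> //.
exists N, k1, k2, r1, r2; split=> //; exists v.
rewrite -uk2 -!cmpA -cmpDr; case: (BN) => _ _ _ _ ->; rewrite cmpm1.
by apply/tri_rot; rewrite -f1kap susm_comp -cmpNr.
Qed.


(** In the octahedron for k v, the connecting map Q2 -> ΣQ1 is the composite of Σ(q1 v e0) and [d2].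
    It vanishes since q1 v = 0, so the cone splits. *)
Lemma tri_comp_sum A B D Q1 Q2 P (v : mor A B) (q1 : mor B Q1) (d1 : mor Q1 (Σ A))
    (k : mor B D) (q2 : mor D Q2) (d2 : mor Q2 (Σ P)) (e0 : mor P A) :
  tri v q1 d1 -> tri k q2 (Σ1 (v \c e0) \c d2) ->
  exists N (x : mor D N) (y : mor N (Σ A)), has_biprod Q1 Q2 N /\ tri (k \c v) x y.
Proof.
move=> t1 t2; have [N [x [y t]]] := tri_cone TC (k \c v).
have [u [w [tuw _ _ _ _]]] := octahedron t1 t2 t.
exists N, x, y; split=> //; apply: (tri_split (TC := TC) (u := u) (v := w)).
move: tuw; rewrite cmpA -susm_comp cmpA (tri_comp0 t1) cmp0l susm0 cmp0l.
exact.
Qed.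

End HomotopyCartesian.

(** * Iterated extensions and their relation to levels *)

Section Extensions.
Local Open Scope ring_scope.
Variables (C : preadd) (TC : triang C).
Local Notation "'Σ'" := (sus TC).
Local Notation "'Σ1'" := (susm TC).
Local Notation tri := (tri TC).
Implicit Types P Q R : C -> Prop.

(** The operation P * Q of Beilinson, Bernstein and Deligne on classes of objects, associative by
    the octahedral axiom. *)
Definition star P Q (A : C) : Prop :=
  exists (B D : C) (u : mor B A) (v : mor A D) (w : mor D (Σ B)), [/\ P B, Q D & tri u v w].

Lemma star_mono P P' Q Q' A :
  (forall B, P B -> P' B) -> (forall B, Q B -> Q' B) -> star P Q A -> star P' Q' A.
Proof. by move=> hP hQ [B [D [u [v [w [/hP ? /hQ ? ?]]]]]]; exists B, D, u, v, w. Qed.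

Lemma star_assocr P Q R A : star (star P Q) R A -> star P (star Q R) A.
Proof.
case=> [B [D [u [v [w [[B1 [B2 [x [y [z [pB qB t1]]]]]] rD t2]]]]]].
have [L [l [m t]]] := tri_cone TC (u \c x).
have [u' [v' [t' _ _ _ _]]] := octahedron t1 t2 t.
exists B1, L, (u \c x), l, m; split=> //.
by eexists _, _, _, _, _; split; [exact: qB | exact: rD | exact: t'].
Qed.

(** The octahedron for [w \c x] on rotated triangles gives D2 -> ΣM -> ΣA, which is desuspended to M
    -> A -> D2. *)
Lemma star_assocl P Q R A : star P (star Q R) A -> star (star P Q) R A.
Proof.
case=> [B [D [u [v [w [pB [D1 [D2 [x [y [z [qD rD t2]]]]]] t1]]]]]].
have [M [b [n t]]] := tri_fiber (w \c x).
have /tri_rot/tri_rot t1' := t1.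
have /tri_rot/tri_rot t' := t.
have [p [q [tpq _ _ _ _]]] := octahedron t2 t1' t'.
have [b' bE] := susm_surj (- q); have [n' nE] := susm_surj (- (Σ1 y \c - Σ1 v)).
exists M, D2, b', n', p; split=> //; first by exists B, D1, b, n, (w \c x).
by apply/tri_rot3; rewrite bE nE !opprK.
Qed.

(** There are n + 1 factors P, so [ext P n] corresponds to level n + 1. *)
Fixpoint ext P n : C -> Prop := if n is n'.+1 then star (ext P n') P else P.

Lemma star_ext P n A : star P (ext P n) A <-> ext P n.+1 A.
Proof.
elim: n A => [|n IH] A; first by [].
split=> [/star_assocl|/=].
  by apply: star_mono => // B /IH.
by move=> h; apply: star_assocr; apply: star_mono h => // B /IH.
Qed.

Lemma thick1_trans X Y Z : thick1 TC X Y -> thick1 TC Y Z -> thick1 TC X Z.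
Proof.
move=> hXY; elim=> //.
- by move=> A _; apply: thick1_sus.
- by move=> A _; apply: thick1_desus.
- by move=> A; apply: thick1_zero.
- by move=> A B D _ hA _ hB; apply: (thick1_coprod hA hB).
- by move=> A B r s _ hA; apply: (thick1_retract hA).
Qed.

Lemma ext_thick X n A Y (s : mor Y A) (r : mor A Y) :
  ext (thick1 TC X) n A -> r \c s = idm Y -> thick TC X n.+1 Y.
Proof.
elim: n A Y s r => [|n IH] A Y s r; first by move=> hA rs; apply: (thick1_retract hA rs).
move=> /star_ext [B [D [u [v [w [hB hD t]]]]]] rs.
have [Y' bp] := retract_summand TC rs.
exists B, D, Y', A, u, v, w; split=> //.
by apply: IH hD _; apply: cmp1m.
Qed.

(** The retractions permitted at every stage are postponed to the end. If Y2 is a retract of E,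
    pulling the triangle back along E -> Y2 gives Y1 -> M -> E. The lifts Sm -> M -> Sm compose to a
    map compatible with the identities of Y1 and Y2, hence to an isomorphism, so Sm and its summand
    Y are retracts of M. *)
Lemma thick_ext X n Y :
  thick TC X n.+1 Y ->
  exists A (s : mor Y A) (r : mor A Y), ext (thick1 TC X) n A /\ r \c s = idm Y.
Proof.
elim: n Y => [|n IH] Y; first by exists Y, (idm Y), (idm Y); rewrite cmp1m.
case=> [Y1 [Y2 [Yt [Sm [a [b [c [hY1 /IH [E [s [r [hE rs]]]]]]]]]]]].
case=> [i1 [i2 [p1 [p2 bp]]]] t.
have [M [m1 [m2 tM]]] := tri_fiber (c \c r).
have trs : c \c r \c s = c by rewrite -cmpA rs cmpm1.
have lift (L L' K K' : C) (x : mor Y1 L) (y : mor L K) z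
    (x' : mor Y1 L') (y' : mor L' K') z' (k : mor K K') : tri x y z -> tri x' y' z' ->
    z' \c k = z -> exists l : mor L L', l \c x = x' /\ y' \c l = k \c y.
  move=> t1 t2 zk; have /tri_rot/tri_rot t1' := t1; have /tri_rot/tri_rot t2' := t2.
  have [|l' [e1 e2]] := tri_fill (u := k) (v := idm _) t1' t2'; first by rewrite cmp1m.
  have [l lE] := susm_surj l'; exists l; split; apply: (@susm_inj _ TC); rewrite susm_comp lE.
    by move: e1; rewrite cmpNr cmpm1 => /oppr_inj.
  by move: e2; rewrite susm_comp cmpNr cmpNl => /oppr_inj.
have [l [lx ly]] := lift _ _ _ _ _ _ _ _ _ _ s t tM trs.
have [l' [lx' ly']] := lift _ _ _ _ _ _ _ _ _ _ r tM t (erefl _).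
have [k [k1 _]] : is_iso (l' \c l).
  have [m [ml lm]] : is_iso (susm TC (l' \c l)).
    have t' := proj1 (tri_rot3 _ _ _) t; apply: (tri_end_iso t').
      by rewrite cmpNr -susm_comp -cmpA lx lx'.
    by rewrite cmpNl -susm_comp cmpA ly' -cmpA ly cmpA rs cmp1m.
  have [k kE] := susm_surj m.
  by exists k; split; apply: (@susm_inj _ TC); rewrite susm_comp kE susm_id.
exists M, (l \c i1), (p1 \c k \c l'); split.
  by apply/star_ext; exists Y1, E, m1, m2, (c \c r).
by rewrite !cmpA -(cmpA _ l') -(cmpA p1) k1 cmpm1; case: bp.
Qed.

End Extensions.

(** * Additive functors commuting with suspension preserve thick^1 *)

Section ThickFunctor.
Local Open Scope ring_scope.
Variables (C D : preadd) (TC : triang C) (TD : triang D).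
Variables (G0 : C -> D) (G1 : forall X Y : C, mor X Y -> mor (G0 X) (G0 Y)).
Hypothesis G_id : forall X, G1 (idm X) = idm (G0 X).
Hypothesis G_comp : forall (X Y Z : C) (g : mor Y Z) (f : mor X Y), G1 (g \c f) = G1 g \c G1 f.
Hypothesis G_add : forall (X Y : C) (f g : mor X Y), G1 (f + g) = G1 f + G1 g.
Hypothesis G_sus : forall X, exists s : mor (G0 (sus TC X)) (sus TD (G0 X)), is_iso s.

Lemma thick1_functor X Y : thick1 TC X Y -> thick1 TD (G0 X) (G0 Y).
Proof.
have G_0 A B : G1 (0 : mor A B) = 0 by apply: (addrI (G1 0)); rewrite -G_add !addr0.
elim=> [|A _ hA|A _ hA|Z Z0|A B E _ hA _ hB bAB|A B r s _ hA rs].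
- exact: thick1_base.
- have [s [r [rs _]]] := G_sus A; exact: (thick1_retract (thick1_sus hA) rs).
- have [s [r [_ sr]]] := G_sus A; apply: thick1_desus; exact: (thick1_retract hA sr).
- apply/thick1_zero/is_zeroP; rewrite -G_id -G_0; congr G1.
  by case: (Z0 Z) => /(_ (idm Z)).
- have [i1 [i2 [p1 [p2 [e11 e22 e12 e21 e]]]]] := bAB.
  apply: (thick1_coprod hA hB); exists (G1 i1), (G1 i2), (G1 p1), (G1 p2).
  by split; rewrite -!G_comp ?(e11, e22, e12, e21) ?G_id ?G_0 // -G_add e G_id.
- by apply: (thick1_retract hA (r := G1 r) (s := G1 s)); rewrite -G_comp rs G_id.
Qed.

End ThickFunctor.

(** It lives in [Type] so that the predicate [filtered] can be defined by recursion on it. The first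
    term is an index since the recursion moves along the tower, and the last term E stays fixed. *)
Inductive tower (C : preadd) (TC : triang C) (P : C -> Prop) (E : C) : C -> nat -> Type :=
| tower_nil : tower TC P E E 0
| tower_cons (Y Y1 Q : C) n (f : mor Y Y1) (g : mor Y1 Q) (h : mor Q (sus TC Y)) :
    tri TC f g h -> P Q -> tower TC P E Y1 n -> tower TC P E Y n.+1.

Lemma ext_tower (C : preadd) (TC : triang C) (P : C -> Prop) E n B k :
  ext TC P n B -> tower TC P E B k ->
  exists B0, P B0 /\ inhabited (tower TC P E B0 (n + k)).
Proof.
elim: n B k => [|n IH] B k hB t; first by exists B; split.
case: hB => [B' [Q [u [v [w [hB' hQ tB]]]]]].
by have := IH _ _ hB' (tower_cons tB hQ t); rewrite addnS.
Qed.

(** * The filtration of F(Y, Y') *)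

Section Biexact.
Local Open Scope ring_scope.
Variables (S T U : preadd) (TS : triang S) (TT : triang T) (TU : triang U).
Variables (F : bifun S T U).
Variable theta : forall (X : S) (X' : T), mor (F0 F (sus TS X) X') (sus TU (F0 F X X')).
Variable zeta : forall (X : S) (X' : T), mor (F0 F X (sus TT X')) (sus TU (F0 F X X')).
Hypothesis Hb : biexact TS TT TU F theta zeta.
Hypothesis Hv : strong_verdier TS TT TU F theta zeta.
Variables (X0 : S) (X0' : T).
Local Notation PS := (thick1 TS X0).
Local Notation PT := (thick1 TT X0').
Local Notation PU := (thick1 TU (F0 F X0 X0')).

Lemma bifun_compl (X Y Z : S) (X' : T) (g : mor Y Z) (f : mor X Y) :
  F1 F (g \c f) (idm X') = F1 F g (idm X') \c F1 F f (idm X').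
Proof. by rewrite -F1_comp cmp1m. Qed.

Lemma bifun_compr (X : S) (X' Y' Z' : T) (g : mor Y' Z') (f : mor X' Y') :
  F1 F (idm X) (g \c f) = F1 F (idm X) g \c F1 F (idm X) f.
Proof. by rewrite -F1_comp cmp1m. Qed.

(** Pass from F(X0, X0') to F(Y, X0') and then to F(Y, Y'), one variable at a time. *)
Lemma bifun_thick1 Y Y' : PS Y -> PT Y' -> PU (F0 F Y Y').
Proof.
case: Hb => isos [_ [_ [addr_ [addl_ _]]]] hY hY'.
apply: (@thick1_trans _ _ _ (F0 F Y X0')).
  apply: (thick1_functor (G0 := fun Z => F0 F Z X0')
    (G1 := fun A B f => F1 F f (idm X0')) _ _ _ _ hY).
  - by move=> X; rewrite F1_id.
  - by move=> *; rewrite bifun_compl.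
  - by move=> *; rewrite addl_.
  - by move=> X; exists (theta X X0'); case: (isos X X0').
apply: (thick1_functor (G0 := fun Z => F0 F Y Z)
  (G1 := fun A B f => F1 F (idm Y) f) _ _ _ _ hY').
- by move=> X; rewrite F1_id.
- by move=> *; rewrite bifun_compr.
- by move=> *; rewrite addr_.
- by move=> X; exists (zeta Y X); case: (isos Y X).
Qed.

Lemma bifun_zerol Z Y' : is_zero Z -> is_zero (F0 F Z Y').
Proof.
case: Hb => _ [_ [_ [_ [addl_ _]]]] Z0.
apply: is_zeroP; rewrite -F1_id; case: (Z0 Z) => /(_ (idm Z)) -> _.
by apply: (addrI (F1 F 0 (idm Y'))); rewrite -addl_ !addr0.
Qed.

Lemma bifun_zeror Y Z : is_zero Z -> is_zero (F0 F Y Z).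
Proof.
case: Hb => _ [_ [_ [addr_ _]]] Z0.
apply: is_zeroP; rewrite -F1_id; case: (Z0 Z) => /(_ (idm Z)) -> _.
by apply: (addrI (F1 F (idm Y) 0)); rewrite -addr_ !addr0.
Qed.

(* [filtered X t a]: [a] extends to a map of towers F(X, Y'_j) -> A_j over [t],
   with [a] as its first term, whose last term F(X, E) -> A_n is a split
   monomorphism and where the cones of the A_j -> A_{j+1} lie in [PU]. *)
Fixpoint filtered (X : S) E B n (t : tower TT PT E B n) {struct t} :
    forall A : U, mor (F0 F X B) A -> Prop :=
  match t in tower _ _ _ B n return forall A : U, mor (F0 F X B) A -> Prop with
  | tower_nil => fun A a => exists r, r \c a = idm _
  | tower_cons Y Y1 Q n f g h _ _ t' => fun A a =>
    exists (A1 : U) (al : mor A A1) (a1 : mor (F0 F X Y1) A1) (N : U) (x : mor A1 N) y,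
      [/\ tri TU al x y, PU N, a1 \c F1 F (idm X) f = al \c a & filtered t' a1]
  end.

Lemma filtered_ext X E B n (t : tower TT PT E B n) m A (a : mor (F0 F X B) A) :
  ext TU PU m A -> filtered t a ->
  exists A' (s : mor (F0 F X E) A') r, ext TU PU (m + n) A' /\ r \c s = idm _.
Proof.
elim: t m A a => [|Y Y1 Q k f g h tf hQ t IH] m A a hA /=.
  by case=> r ra; exists A, a, r; rewrite addn0.
case=> [A1 [al [a1 [N [x [y [tal hN _ ft]]]]]]].
have hA1 : ext TU PU m.+1 A1 by exists A, N, al, x, y.
by have := IH _ _ _ hA1 ft; rewrite addnS.
Qed.

Lemma filtered_id X E B n (t : tower TT PT E B n) :
  PS X -> filtered t (idm (F0 F X B)).
Proof.
move=> hX; elim: t => [|Y Y1 Q k f g h tf hQ t IH] /=; first by exists (idm _); rewrite cmp1m.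
exists (F0 F X Y1), (F1 F (idm X) f), (idm _), (F0 F X Q).
case: Hb => _ [_ [_ [_ [_ [exr _]]]]].
eexists _, _; split; [exact: exr tf | exact: bifun_thick1 | by rewrite cmp1m cmpm1 | exact: IH].
Qed.

(* [K] is the pushout of [a] and F(f, B). Along F(f, B0) -> F(f, B1) the pushout
   grows in two steps K -> D -> K1, where D is the pushout of A1 over F(X, B0)
   and, equally, the pushout of W over F(X, B1); the two steps have cones
   cone(A -> A1) and F(Z, Q'). The new tower consists of the objects D, and cones
   are computed for V -> K -> D: there the connecting map vanishes because
   A -> K factors through V. *)
Lemma filtered_step X Y Z (f : mor X Y) (g : mor Y Z) h E B n (t : tower TT PT E B n)
    (A V K Q : U) (a : mor (F0 F X B) A) (e0 : mor A V) (v : mor V K) (c : mor (F0 F Y B) K)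
    (q : mor K Q) d :
  tri TS f g h -> PS Z -> filtered t a ->
  hcart TU a (F1 F f (idm B)) (v \c e0) c -> tri TU v q d -> PU Q ->
  exists D (k : mor K D) N (x : mor D N) y,
    [/\ tri TU (k \c v) x y, PU N & filtered t (k \c c)].
Proof.
move=> tf hZ; elim: t A V K Q a e0 v c q d =>
    [|B0 B1 Q' k f' g' h' tf' hQ' t IH] A V K Q a e0 v c q d /=.
  case=> r ra hc tv hQ.
  (* A retraction of [a] induces one of its pushout [c], so D = K works. *)
  have [|z [_ zc]] := hcart_univ (x := F1 F f (idm E) \c r) (y := idm _) hc.
    by rewrite -cmpA ra cmpm1 cmp1m.
  exists K, (idm K), Q, q, d; rewrite !cmp1m; split=> //; by exists z.
case=> [A1 [al [a1 [N [x [y [tal hN ea1 ft]]]]]]] hc tv hQ.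
have [D [dd [dd' hD]]] := hcart_pushout TU (al \c a) (F1 F f (idm B0)).
have [ka [_ kac hK]] := hcart_cancel hc hD.
have [q2 [_ tka]] := hcart_cone hK tal.
(* By cancellation K -> D is a pushout of A -> A1 along [v \c e0], so its connecting map factors
   through Σ(v e0) and the cone of V -> D is Q + N. *)
have [N' [x' [y' [bN' tN']]]] := tri_comp_sum tv tka.
have [W [j [qW [i [p [j' [qW' HW]]]]]]] := Hv tf tf'.
case: HW => -[_ ti _] [[_ ij ij'] [_ [[hW _ _ _ _] _]]].
(* The two composites F(X, B0) -> A1 agree, so square (I) can be cancelled from the square of D: D
   is also the pushout of W along [a1]. *)
rewrite -ea1 in hD.
have [w [_ wj' hw]] := hcart_cancel hW hD.
(* Since i j = F(f, B1), K1 is the pushout required at the next stage. Cancelling W shows that D ->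
   K1 is a pushout of [i], whose cone is F(Z, Q'). *)
have [K1 [c1 [d1 hK1]]] := hcart_pushout TU (i \c j) a1.
have [v1 [v1w v1d hv1]] := hcart_cancel hw hK1.
have [q3 [_ tv1]] := hcart_cone hv1 ti.
rewrite ij -v1d in hK1.
have [D1 [k1 [N1 [x1 [y1 [tk1 hN1 ft1]]]]]] :=
  IH _ _ _ _ _ _ _ _ _ _ ft (hcart_sym hK1) tv1 (bifun_thick1 hZ hQ').
exists D, ka, N', x', y'; split=> //; first exact: (thick1_coprod hQ hN bN').
exists D1, (k1 \c v1), (k1 \c c1), N1, x1, y1; split=> //.
(* Strict compatibility comes from W: c1 F(Y, f') = c1 i j' = v1 w j' = v1 ka c. *)
by rewrite -ij' kac -wj' -!cmpA (cmpA c1) -v1w !cmpA.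
Qed.

Lemma filtered_exists m X E B n (t : tower TT PT E B n) :
  ext TS PS m X -> PT B -> exists A (a : mor (F0 F X B) A), ext TU PU m A /\ filtered t a.
Proof.
elim: m X => [|m IH] X hX hB.
  exists (F0 F X B), (idm _); split; [exact: bifun_thick1 | exact: filtered_id].
case: hX => [X1 [Z [f [g [h [/IH/(_ hB) [A [a [hA fa]]] hZ tf]]]]]].
have [K [e [c hc]]] := hcart_pushout TU a (F1 F f (idm B)).
case: Hb => _ [_ [_ [_ [_ [_ [exl _]]]]]].
have [q [_ te]] := hcart_cone hc (exl B _ _ _ _ _ _ tf).
(* The step starts with V = A and [e0] the identity. *)
rewrite -(cmpm1 e) in hc.
have [D [k [N [x [y [tk hN fk]]]]]] := filtered_step tf hZ fa hc te (bifun_thick1 hZ hB).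
by exists D, (k \c c); split=> //; exists A, N, (k \c e), x, y.
Qed.

Lemma bifun_thick Y Y' m n :
  thick TS X0 m.+1 Y -> thick TT X0' n.+1 Y' -> thick TU (F0 F X0 X0') (m + n).+1 (F0 F Y Y').
Proof.
move=> /thick_ext[M [s [r [hM rs]]]] /thick_ext[M' [s' [r' [hM' rs']]]].
have [B [hB [t]]] := ext_tower hM' (tower_nil TT PT M').
have [A [a [hA fa]]] := filtered_exists t hM hB.
have [A' [z [w [hA' wz]]]] := filtered_ext hA fa.
rewrite addn0 in hA'.
apply: (ext_thick (s := z \c F1 F s s') (r := F1 F r r' \c w) hA').
by rewrite !cmpA -(cmpA _ w) wz cmpm1 -F1_comp rs rs' F1_id.
Qed.

End Biexact.

Theorem theorem3p6 (S T U : preadd) (TS : triang S) (TT : triang T) (TU : triang U)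
    (F : bifun S T U)
    (theta : forall (X : S) (X' : T), mor (F0 F (sus TS X) X') (sus TU (F0 F X X')))
    (zeta : forall (X : S) (X' : T), mor (F0 F X (sus TT X')) (sus TU (F0 F X X')))
    (Hbiexact : biexact TS TT TU F theta zeta)
    (Hverdier : strong_verdier TS TT TU F theta zeta)
    (X Y : S) (X' Y' : T) (m n : nat) :
  level_le TS X Y m -> level_le TT X' Y' n ->
  level_le TU (F0 F X X') (F0 F Y Y') (m + n - 1).
Proof.
(* If either object has level 0, then F(Y, Y') is zero and has level 0, so the bound holds even
   where the subtraction truncates. *)
case=> [[|m'] [lm hY]]; first by exists 0; split=> //; apply: (bifun_zerol Hbiexact).
case=> [[|n'] [ln hY']]; first by exists 0; split=> //; apply: (bifun_zeror Hbiexact).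
exists (m' + n').+1; split; last exact: (bifun_thick Hbiexact Hverdier).
by have := leq_add lm ln; rewrite ltn_subRL addSn addnS.
Qed.
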